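(* Let $(\Omega,\Sigma,\mu)$ be a semifinite, decomposable measure space, let $\mathfrak{B}((\Omega,\mu))$ be its measure algebra and let $\Lambda$ be the spectrum of $L^\infty(\Omega,\mu)$. Then ultrafilters on $\mathfrak{B}((\Omega,\mu))$ and elements of $\Lambda$ are in one-to-one correspondence with each other via the two maps $$\{\text{ultrafilters on }\mathfrak{B}((\Omega,\mu))\}\ni \mathcal{U}\mapsto \omega_{\mathcal{U}}\in\Lambda,\qquad \Lambda\ni\omega\mapsto\mathcal{U}_\omega\in\{\text{ultrafilters on }\mathfrak{B}((\Omega,\mu))\},$$ which are inverses of each other.
   Context: Semifinite: every measurable $E$ with $\mu(E)=\infty$ contains a measurable $F$ with $0<\mu(F)<\infty$. Decomposable: there is a family $\mathcal{F}\subseteq\Sigma$ of pairwise disjoint sets of finite measure with union $\Omega$ such that (i) $\mu(E)=\sum_{F\in\mathcal{F}}\mu(E\cap F)$ whenever $\mu(E)<\infty$, and (ii) if $E\subseteq\Omega$ and $E\cap F\in\Sigma$ for all $F\in\mathcal{F}$, then $E\in\Sigma$. For such spaces $L^\infty(\Omega,\mu)=L^1(\Omega,\mu)^*$ is an abelian von Neumann algebra. $\mathfrak{B}((\Omega,\mu))$ is the Boolean algebra of measurable sets modulo null sets (two sets are identified if their symmetric difference is $\mu$-null), with operations induced by intersection, union, complement. Elements are denoted by representatives. For an ultrafilter $\mathcal{U}$ on $\mathfrak{B}((\Omega,\mu))$ and $f\in L^\infty(\Omega,\mu)$, $\lim_{\mathcal{U}}f=a\in\mathbb{C}$ means: for every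 $\varepsilon>0$ there is $F\in\mathcal{U}$ such that for all measurable $X\subseteq F$ with $0<\mu(X)<\infty$, $\left|\frac{1}{\mu(X)}\int_X f\,d\mu-a\right|<\varepsilon$. This limit exists and is unique for every $f$, and $\omega_{\mathcal{U}}(f)=\lim_{\mathcal{U}}f$ is a character of $L^\infty(\Omega,\mu)$, i.e. $\omega_{\mathcal U}\in\Lambda$. $\Lambda$ is the (compact Hausdorff) space of characters of $L^\infty(\Omega,\mu)\cong C(\Lambda)$. Clopen subsets $K\subseteq\Lambda$ correspond to projections $1_K\in C(\Lambda)=L^\infty(\Omega,\mu)$, hence to elements of $\mathfrak{B}((\Omega,\mu))$; this Boolean algebra isomorphism from clopen subsets of $\Lambda$ onto $\mathfrak{B}((\Omega,\mu))$ is denoted $\mathfrak{b}$. For $\omega\in\Lambda$, $\mathcal{U}_\omega=\{\mathfrak{b}(K): K\text{ a clopen neighborhood of }\omega\}$, which is an ultrafilter on $\mathfrak{B}((\Omega,\mu))$. *)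

(* Defs.v *)
From HB Require Import structures.
From mathcomp Require Import all_boot all_order all_algebra.
From mathcomp Require Import generic_quotient complex.
From mathcomp Require Import all_classical all_reals all_analysis.
From mathcomp Require Import measurable_realfun.

Set Implicit Arguments.
Unset Strict Implicit.
Unset Printing Implicit Defensive.

Import Order.TTheory GRing.Theory Num.Theory numFieldNormedType.Exports.

Local Open Scope classical_set_scope.
Local Open Scope ring_scope.
Local Open Scope quotient_scope.

Section MeasureSpaces.
Context d (T : measurableType d) (R : realType).
Variable mu : {measure set T -> \bar R}.

Definition semifinite := forall E : set T, measurable E -> mu E = +oo%E ->
  exists F : set T, [/\ measurable F, F `<=` E & (0 < mu F < +oo)%E].

Definition decomposable := exists FF : set (set T),
  [/\ FF `<=` measurable,
      forall F, FF F -> (mu F < +oo)%E,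
      trivIset FF id /\ \bigcup_(F in FF) F = setT,
      forall E, measurable E -> (mu E < +oo)%E ->
        mu E = \esum_(F in FF) mu (E `&` F) &
      forall E, (forall F, FF F -> measurable (E `&` F)) -> measurable E].

End MeasureSpaces.

Section BooleanUltrafilters.
Context {disp : Order.disp_t} {B : ctbDistrLatticeType disp}.
Implicit Types U V : set B.

Definition is_proper_filter U :=
  [/\ U \top%O, ~ U \bot%O,
      forall a b, U a -> U b -> U (a `&` b)%O &
      forall a b, (a <= b)%O -> U a -> U b].

Definition is_ultrafilter U := is_proper_filter U /\
  forall V, is_proper_filter V -> U `<=` V -> V = U.

End BooleanUltrafilters.

Definition ultrafilter disp (B : ctbDistrLatticeType disp) :=
  set_type [set U : set B | is_ultrafilter U].

Fact measure_algebra_display : Order.disp_t.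
Proof. exact: Order.Disp tt tt. Qed.

Section MeasureAlgebra.
Context d (T : measurableType d) (R : realType).
Variable mu : {measure set T -> \bar R}.

Definition mblset := {A : set T | `[< measurable A >]}.
HB.instance Definition _ := Choice.on mblset.

Implicit Types A B C : mblset.

Let mblsetP A : measurable (val A). Proof. exact/asboolP/(valP A). Qed.
Hint Resolve mblsetP : core.

Definition MblSet (A : set T) (mA : measurable A) : mblset :=
  exist _ A (asboolT mA).

Definition mblset0 : mblset := MblSet measurable0.
Definition mblsetT : mblset := MblSet measurableT.
Definition mblsetI A B : mblset :=
  MblSet (measurableI _ _ (mblsetP A) (mblsetP B)).
Definition mblsetU A B : mblset :=
  MblSet (measurableU _ _ (mblsetP A) (mblsetP B)).
Definition mblsetD A B : mblset := MblSet (measurableD (mblsetP A) (mblsetP B)).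
Definition mblsetC A : mblset := MblSet (measurableC (mblsetP A)).

Definition meq : rel mblset := fun A B => `[< mu (val A `+` val B) = 0%E >].

Let meqP A B : reflect ({ae mu, forall x, val A x = val B x}) (meq A B).
Proof.
have mAB : measurable (val A `+` val B).
  by apply: measurableU; exact: measurableD.
apply: (iffP (asboolP _)) => [/(negligibleP _ mAB)|h].
- apply: negligibleS => x /= AB; rewrite /setY /setU /setD /=.
  have [Ax|nAx] := pselect (val A x); have [Bx|nBx] := pselect (val B x).
  + by case: AB; apply/propext; split.
  + by left.
  + by right.
  + by case: AB; apply/propext; split.
- apply/(negligibleP _ mAB); apply: negligibleS h => x /= [[Ax nBx]|[Bx nAx]] e.
  + by apply: nBx; rewrite -e.
  + by apply: nAx; rewrite e.
Qed.

Let meq_refl : reflexive meq.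
Proof. by move=> A; apply/meqP; apply: aeW. Qed.

Let meq_sym : symmetric meq.
Proof.
by move=> A B; apply/meqP/meqP; apply: filterS => x.
Qed.

Let meq_trans : transitive meq.
Proof.
by move=> B A C /meqP h1 /meqP h2; apply/meqP; apply: filterS2 h1 h2 => x ->.
Qed.

Canonical meq_equiv := EquivRel meq meq_refl meq_sym meq_trans.

Definition measure_algebra : Type := {eq_quot meq}.
HB.instance Definition _ := Choice.on measure_algebra.
HB.instance Definition _ := EqQuotient.on measure_algebra.

Local Notation mc := (\pi_measure_algebra).

(* [lift_op2] and [lift_op1] compute on representatives; compatibility with the
   quotient is [malgIE], [malgUE], [malgDE], [malgCE] below *)
Definition malg0 : measure_algebra := mc mblset0.
Definition malgT : measure_algebra := mc mblsetT.
Definition malgI := lift_op2 measure_algebra mblsetI.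
Definition malgU := lift_op2 measure_algebra mblsetU.
Definition malgD := lift_op2 measure_algebra mblsetD.
Definition malgC := lift_op1 measure_algebra mblsetC.

Lemma malg_piP A B : mc A = mc B <-> {ae mu, forall x, val A x = val B x}.
Proof.
split=> [/eqP|] h; first by apply/meqP; move: h; rewrite eqmodE.
by apply/eqP; rewrite eqmodE; apply/meqP.
Qed.

Let mcK A : {ae mu, forall x, val (repr (mc A)) x = val A x}.
Proof. by apply: (proj1 (malg_piP (repr (mc A)) A)); rewrite reprK. Qed.

Lemma malgIE A B : malgI (mc A) (mc B) = mc (mblsetI A B).
Proof.
rewrite /malgI -lock; apply/malg_piP.
by apply: filterS2 (mcK A) (mcK B) => x /= a b; rewrite /setI /= a b.
Qed.

Lemma malgUE A B : malgU (mc A) (mc B) = mc (mblsetU A B).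
Proof.
rewrite /malgU -lock; apply/malg_piP.
by apply: filterS2 (mcK A) (mcK B) => x /= a b; rewrite /setU /= a b.
Qed.

Lemma malgDE A B : malgD (mc A) (mc B) = mc (mblsetD A B).
Proof.
rewrite /malgD -lock; apply/malg_piP.
by apply: filterS2 (mcK A) (mcK B) => x /= a b; rewrite /setD /= a b.
Qed.

Lemma malgCE A : malgC (mc A) = mc (mblsetC A).
Proof.
rewrite /malgC -lock; apply/malg_piP.
by apply: filterS (mcK A) => x /= a; rewrite /setC /= a.
Qed.

Let malgE := (malgIE, malgUE, malgDE, malgCE).

Let mblset_eq A B : val A = val B -> mc A = mc B.
Proof. by move=> /val_inj ->. Qed.

Definition malg_le (a b : measure_algebra) := malgI a b == a.
Definition malg_lt (a b : measure_algebra) := (b != a) && malg_le a b.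

Let malgIC : commutative malgI.
Proof.
elim/quotW => A; elim/quotW => B.
by rewrite !malgE; apply: mblset_eq; exact: setIC.
Qed.
Let malgUC : commutative malgU.
Proof.
elim/quotW => A; elim/quotW => B.
by rewrite !malgE; apply: mblset_eq; exact: setUC.
Qed.
Let malgIA : associative malgI.
Proof.
elim/quotW => A; elim/quotW => B; elim/quotW => C.
by rewrite !malgE; apply: mblset_eq; exact: setIA.
Qed.
Let malgUA : associative malgU.
Proof.
elim/quotW => A; elim/quotW => B; elim/quotW => C.
by rewrite !malgE; apply: mblset_eq; exact: setUA.
Qed.
Let malgKI (b a : measure_algebra) : malgI a (malgU a b) = a.
Proof.
elim/quotW: a => A; elim/quotW: b => B.
by rewrite !malgE; apply/mblset_eq; rewrite /= setUC setKU.
Qed.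
Let malgKU (b a : measure_algebra) : malgU a (malgI a b) = a.
Proof.
elim/quotW: a => A; elim/quotW: b => B.
by rewrite !malgE; apply/mblset_eq; rewrite /= setIC setKI.
Qed.
Let malgIUl : left_distributive malgI malgU.
Proof.
elim/quotW => A; elim/quotW => B; elim/quotW => C.
by rewrite !malgE; apply: mblset_eq; exact: setIUl.
Qed.
Let malgII : idempotent_op malgI.
Proof. by elim/quotW => A; rewrite !malgE; apply: mblset_eq; exact: setIid. Qed.

HB.instance Definition _ := Order.isMeetJoinDistrLattice.Build
  measure_algebra_display measure_algebra (le := malg_le) (lt := malg_lt)
  (fun _ _ => erefl) (fun _ _ => erefl)
  malgIC malgUC malgIA malgUA malgKI malgKU malgIUl malgII.

Let malg_le0 (a : measure_algebra) : (malg0 <= a)%O.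
Proof.
by elim/quotW: a => A; apply/eqP; rewrite malgE; apply: mblset_eq; exact: set0I.
Qed.

Let malg_leT (a : measure_algebra) : (a <= malgT)%O.
Proof.
by elim/quotW: a => A; apply/eqP; rewrite malgE; apply: mblset_eq; exact: setIT.
Qed.

HB.instance Definition _ := Order.hasBottom.Build
  measure_algebra_display measure_algebra malg_le0.
HB.instance Definition _ := Order.hasTop.Build
  measure_algebra_display measure_algebra malg_leT.

Let malgKD (a b : measure_algebra) : malgI b (malgD a b) = malg0.
Proof.
elim/quotW: a => A; elim/quotW: b => B; rewrite !malgE; apply/mblset_eq => /=.
by rewrite setDE setICA setICr setI0.
Qed.

Let malgID (a b : measure_algebra) : malgU (malgI a b) (malgD a b) = a.
Proof.
elim/quotW: a => A; elim/quotW: b => B; rewrite !malgE; apply/mblset_eq => /=.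
by rewrite setUC -setDDr setDv setD0.
Qed.

HB.instance Definition _ := Order.BDistrLattice_hasSectionalComplement.Build
  measure_algebra_display measure_algebra malgKD malgID.

Let malgCD (a : measure_algebra) : malgC a = malgD malgT a.
Proof.
by elim/quotW: a => A; rewrite !malgE; apply/mblset_eq; rewrite /= setTD.
Qed.

HB.instance Definition _ := Order.CBDistrLattice_hasComplement.Build
  measure_algebra_display measure_algebra malgCD.


End MeasureAlgebra.

Section Linfty.
Context d (T : measurableType d) (R : realType).
Variable mu : {measure set T -> \bar R}.
Local Open Scope complex_scope.

Definition complex_measurable (f : T -> R[i]) :=
  measurable_fun setT (fun x => complex.Re (f x)) /\
  measurable_fun setT (fun x => complex.Im (f x)).

(* The norm of [R[i]] is [R[i]]-valued and [z <= M%:C] forces [z] to be real *)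
Definition ess_bounded (f : T -> R[i]) :=
  exists M : R, {ae mu, forall x, `|f x| <= M%:C}.

Definition Linf_pred : {pred T -> R[i]} :=
  fun f => `[< complex_measurable f /\ ess_bounded f >].

Let Linf_subring : subring_closed Linf_pred.
Proof.
split.
- apply/asboolP; split.
    by split; exact: measurable_cst.
  by exists 1; apply: aeW => x /=; rewrite normr1.
- move=> f g /asboolP[[f1 f2] [M hM]] /asboolP[[g1 g2] [N hN]].
  apply/asboolP; split.
    split.
    + rewrite (_ : (fun _ => _) =
        (fun x => complex.Re (f x)) \- (fun x => complex.Re (g x))).
        exact: measurable_funB.
      by apply/funext => x /=; rewrite -raddfB.
    + rewrite (_ : (fun _ => _) =
        (fun x => complex.Im (f x)) \- (fun x => complex.Im (g x))).
        exact: measurable_funB.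
      by apply/funext => x /=; rewrite -raddfB.
  exists (M + N); apply: filterS2 hM hN => x hf hg.
  by rewrite rmorphD /=; apply: le_trans (ler_normB _ _) _; exact: lerD.
- move=> f g /asboolP[[f1 f2] [M hM]] /asboolP[[g1 g2] [N hN]].
  apply/asboolP; split.
    split.
    + rewrite (_ : (fun _ => _) =
        ((fun x => complex.Re (f x)) \* (fun x => complex.Re (g x))) \-
        ((fun x => complex.Im (f x)) \* (fun x => complex.Im (g x)))).
        by apply: measurable_funB; exact: measurable_funM.
      by apply/funext => x; rewrite /GRing.mul /=; case: (f x) (g x) => a b [].
    + rewrite (_ : (fun _ => _) =
        ((fun x => complex.Re (f x)) \* (fun x => complex.Im (g x))) \+
        ((fun x => complex.Im (f x)) \* (fun x => complex.Re (g x)))).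
        by apply: measurable_funD; exact: measurable_funM.
      by apply/funext => x; rewrite /GRing.mul /=; case: (f x) (g x) => a b [].
  exists (M * N); apply: filterS2 hM hN => x hf hg.
  rewrite rmorphM [X in `|X|](_ : _ = f x * g x) // normrM.
  exact: ler_pM.
Qed.
HB.instance Definition _ :=
  GRing.isSubringClosed.Build (T -> R[i]) Linf_pred Linf_subring.

Let Linf_scaler : scaler_closed Linf_pred.
Proof.
move=> a f Lf; rewrite (_ : a *: f = cst a * f) //.
apply: rpredM => //; apply/asboolP; split.
  by split; exact: measurable_cst.
exists (complex.Re `|a|); apply: aeW => x.
by rewrite RRe_real // normr_real.
Qed.
HB.instance Definition _ :=
  GRing.isScaleClosed.Build R[i] (T -> R[i]) Linf_pred Linf_scaler.

Definition Linf_fun := {f : T -> R[i] | Linf_pred f}.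
HB.instance Definition _ := SubType.on Linf_fun.
HB.instance Definition _ := Choice.on Linf_fun.
HB.instance Definition _ :=
  GRing.SubChoice_isSubComPzRing.Build (T -> R[i]) Linf_pred Linf_fun
    Linf_subring.
HB.instance Definition _ := [SubZmodule_isSubLmodule of Linf_fun by <:].

Definition Linf_eq : rel Linf_fun :=
  fun f g => `[< {ae mu, forall x, val f x = val g x} >].

Let Linf_eq_refl : reflexive Linf_eq.
Proof. by move=> f; apply/asboolP/aeW. Qed.

Let Linf_eq_sym : symmetric Linf_eq.
Proof. by move=> f g; apply/asboolP/asboolP; apply: filterS. Qed.

Let Linf_eq_trans : transitive Linf_eq.
Proof.
move=> g f h /asboolP fg /asboolP gh; apply/asboolP.
by apply: filterS2 fg gh => x ->.
Qed.

Canonical Linf_eq_equiv :=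
  EquivRel Linf_eq Linf_eq_refl Linf_eq_sym Linf_eq_trans.

(* [Linf] is the zero ring when [mu] vanishes: hence the [comPzRingType]
   structure, and not the library's algebra structures, which need [1 != 0] *)
Definition Linf : Type := {eq_quot Linf_eq}.
HB.instance Definition _ := Choice.on Linf.
HB.instance Definition _ := EqQuotient.on Linf.

Local Notation pi := (\pi_Linf).

Definition Linf_opp := lift_op1 Linf -%R.
Definition Linf_add := lift_op2 Linf +%R.
Definition Linf_mul := lift_op2 Linf *%R.
Definition Linf_scale (a : R[i]) := lift_op1 Linf ( *:%R a).

Lemma Linf_piP (f g : Linf_fun) :
  pi f = pi g <-> {ae mu, forall x, val f x = val g x}.
Proof.
split=> [/eqP|] h; first by apply/asboolP; move: h; rewrite eqmodE.
by apply/eqP; rewrite eqmodE; apply/asboolP.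
Qed.

Let piK (f : Linf_fun) : {ae mu, forall x, val (repr (pi f)) x = val f x}.
Proof. by apply: (proj1 (Linf_piP (repr (pi f)) f)); rewrite reprK. Qed.

Lemma Linf_oppE (f : Linf_fun) : Linf_opp (pi f) = pi (- f).
Proof.
rewrite /Linf_opp -lock; apply/Linf_piP.
by apply: filterS (piK f) => x fE; rewrite !raddfN; exact: congr1 fE.
Qed.

Lemma Linf_addE (f g : Linf_fun) : Linf_add (pi f) (pi g) = pi (f + g).
Proof.
rewrite /Linf_add -lock; apply/Linf_piP.
apply: filterS2 (piK f) (piK g) => x fE gE.
by rewrite !raddfD; exact: congr2 fE gE.
Qed.

Lemma Linf_mulE (f g : Linf_fun) : Linf_mul (pi f) (pi g) = pi (f * g).
Proof.
rewrite /Linf_mul -lock; apply/Linf_piP.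
apply: filterS2 (piK f) (piK g) => x fE gE.
by rewrite !rmorphM; exact: congr2 fE gE.
Qed.

Lemma Linf_scaleE a (f : Linf_fun) : Linf_scale a (pi f) = pi (a *: f).
Proof.
rewrite /Linf_scale -lock; apply/Linf_piP.
by apply: filterS (piK f) => x fE; rewrite !linearZ; exact: congr1 fE.
Qed.

Let LinfE := (Linf_oppE, Linf_addE, Linf_mulE, Linf_scaleE).

Let Linf_addA : associative Linf_add.
Proof.
by elim/quotW => f; elim/quotW => g; elim/quotW => h; rewrite !LinfE addrA.
Qed.
Let Linf_addC : commutative Linf_add.
Proof. by elim/quotW => f; elim/quotW => g; rewrite !LinfE addrC. Qed.
Let Linf_add0 : left_id (pi 0) Linf_add.
Proof. by elim/quotW => f; rewrite !LinfE add0r. Qed.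
Let Linf_addN : left_inverse (pi 0) Linf_opp Linf_add.
Proof. by elim/quotW => f; rewrite !LinfE addNr. Qed.
HB.instance Definition _ :=
  GRing.isZmodule.Build Linf Linf_addA Linf_addC Linf_add0 Linf_addN.

Let Linf_mulA : associative Linf_mul.
Proof.
by elim/quotW => f; elim/quotW => g; elim/quotW => h; rewrite !LinfE mulrA.
Qed.
Let Linf_mulC : commutative Linf_mul.
Proof. by elim/quotW => f; elim/quotW => g; rewrite !LinfE mulrC. Qed.
Let Linf_mul1 : left_id (pi 1) Linf_mul.
Proof. by elim/quotW => f; rewrite !LinfE mul1r. Qed.
Let Linf_mulD : left_distributive Linf_mul +%R.
Proof.
elim/quotW => f; elim/quotW => g; elim/quotW => h.
by rewrite /GRing.add /= !LinfE mulrDl.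
Qed.
HB.instance Definition _ := GRing.Zmodule_isComPzRing.Build Linf
  Linf_mulA Linf_mulC Linf_mul1 Linf_mulD.

Let Linf_scaleA a b (f : Linf) :
  Linf_scale a (Linf_scale b f) = Linf_scale (a * b) f.
Proof. by elim/quotW: f => f; rewrite !LinfE scalerA. Qed.
Let Linf_scale1 : left_id 1 Linf_scale.
Proof. by elim/quotW => f; rewrite LinfE scale1r. Qed.
Let Linf_scaleDr : right_distributive Linf_scale +%R.
Proof.
move=> a; elim/quotW => f; elim/quotW => g.
by rewrite /GRing.add /= !LinfE scalerDr.
Qed.
Let Linf_scaleDl (f : Linf) : {morph Linf_scale^~ f : a b / a + b}.
Proof.
by elim/quotW: f => f a b; rewrite [in RHS]/GRing.add /= !LinfE scalerDl.
Qed.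
HB.instance Definition _ := GRing.Zmodule_isLmodule.Build R[i] Linf
  Linf_scaleA Linf_scale1 Linf_scaleDr Linf_scaleDl.

End Linfty.

Section Spectrum.
Context d (T : measurableType d) (R : realType).
Variable mu : {measure set T -> \bar R}.
Local Open Scope complex_scope.

(* Continuity and compatibility with conjugation are automatic for nonzero
   multiplicative functionals on [Linf mu] *)
Definition is_character (w : Linf mu -> R[i]) :=
  [/\ scalar w, {morph w : f g / f * g} & exists f, w f <> 0].

(* [R[i]] carries its topology only as a [numFieldType], whence the cast.
   As a [set_type], the spectrum gets the topology induced by the
   product topology, i.e. that of pointwise convergence on [Linf mu] *)
Definition spectrum := set_type [set w :
  prod_topology (fun _ : Linf mu => (R[i] : numFieldType)) | is_character w].
HB.instance Definition _ := Topological.on spectrum.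

Definition gelfand (f : Linf mu) : spectrum -> R[i] := fun w => \val w f.

Let Linf_pred_indic (A : mblset T) : Linf_pred mu \1_(val A).
Proof.
have mA : measurable (val A) by exact/asboolP/(valP A).
apply/asboolP; split; last first.
  exists 1; apply: aeW => x; rewrite indicE rmorph1.
  by case: (_ \in _); rewrite ?normr1 ?normr0.
split.
- rewrite (_ : (fun _ => _) = \1_(val A)); first exact: measurable_indic.
  by apply/funext => x; rewrite !indicE; case: (_ \in _).
- rewrite (_ : (fun _ => _) = cst 0); first exact: measurable_cst.
  by apply/funext => x; rewrite indicE; case: (_ \in _).
Qed.

Definition Linf_fun_indic (A : mblset T) : Linf_fun mu :=
  exist _ \1_(val A) (Linf_pred_indic A).

Definition Linf_indic (e : measure_algebra mu) : Linf mu :=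
  \pi_(Linf mu) (Linf_fun_indic (repr e)).

Lemma Linf_indicE (A : mblset T) :
  Linf_indic (\pi_(measure_algebra mu) A) = \pi_(Linf mu) (Linf_fun_indic A).
Proof.
apply/Linf_piP; have /malg_piP := reprK (\pi_(measure_algebra mu) A).
apply: filterS => x e; rewrite /= !indicE; congr (_%:R); congr nat_of_bool.
by apply/idP/idP => /set_mem Ax; apply/mem_set; [rewrite -e | rewrite e].
Qed.

(* The inverse, on clopen sets, of the map sending [e] to the clopen set whose
   indicator is the Gelfand transform of the projection [Linf_indic e]; the
   default value is a convention, as every clopen set comes from a unique [e] *)
Definition clopen_to_malg (K : set spectrum) : measure_algebra mu :=
  xget \bot%O [set e | gelfand (Linf_indic e) = \1_K].

Definition ultrafilter_at (w : spectrum) : set (measure_algebra mu) :=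
  [set clopen_to_malg K | K in [set K | clopen K /\ K w]].

(* The integral of a complex function is taken componentwise *)
Definition average (X : set T) (f : T -> R[i]) : R[i] :=
  ((fine (mu X))^-1)%:C *
  ((\int[mu]_(x in X) complex.Re (f x)) +i*
   (\int[mu]_(x in X) complex.Im (f x))).

(* Neither the choice of [F] in its class nor that of [repr f] matters: the
   averages only depend on [X] and [f] up to null sets *)
Definition ultralim (U : set (measure_algebra mu)) (f : Linf mu) (a : R[i]) :=
  forall eps : R, 0 < eps ->
  exists F : mblset T, U (\pi_(measure_algebra mu) F) /\
    forall X : set T, measurable X -> X `<=` val F -> (0 < mu X < +oo)%E ->
      `|average X (val (repr f)) - a| < eps%:C.

End Spectrum.

(* Main.v *)
(* Along an ultrafilter U on the measure algebra every f in L^oo has a limit, as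
   f is essentially bounded and each measurable set or its complement is in U;
   limits respect the algebra operations, which gives a character. It is also
   the limit of the averages of f, because these stay close to the limit on small
   enough members of U; semifiniteness makes the limit of averages unique.
   Conversely a character w is {0,1}-valued on indicators, and
   V = {e | w(1_e) = 1} is an ultrafilter along which every f tends to w(f).
   Finally V is the set of clopen neighbourhoods of w, because the clopen sets of
   the spectrum are exactly the sets {w | w(1_e) = 1}, each given by a single e. *)
Require Import Defs.
From mathcomp Require Import all_boot all_order all_algebra.
From mathcomp Require Import generic_quotient complex.
From mathcomp Require Import all_classical all_reals all_analysis.
From mathcomp Require Import measurable_realfun lra.

Set Implicit Arguments.
Unset Strict Implicit.
Unset Printing Implicit Defensive.

Import Order.Theory GRing.Theory Num.Theory numFieldNormedType.Exports.

Local Open Scope classical_set_scope.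
Local Open Scope ring_scope.
Local Open Scope quotient_scope.

(** * Convergence of complex functions along filters and ultrafilters *)

Lemma fmap_ultra {I J : Type} (f : I -> J) (F : set_system I) :
  UltraFilter F -> UltraFilter (f @ F).
Proof.
move=> UF; have PF : ProperFilter F := ultra_proper.
split=> [|G PG FG]; first exact: fmap_proper_filter.
apply/seteqP; split=> // A GA.
have [//|FnA] := in_ultra_setVsetC (f @^-1` A) UF.
have GnA : G (~` A) by exact: FG.
by have [x [Ax]] := filter_ex (filterI GA GnA).
Qed.

Section ComplexConvergence.
Context {R : realType}.
Local Open Scope complex_scope.
Local Notation C := (R[i] : numFieldType).

Lemma normc_le_ReIm (z : R[i]) :
  `|z| <= (`|complex.Re z| + `|complex.Im z|)%:C.
Proof.
case: z => a b; rewrite normc_def lecR /=.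
rewrite -[leRHS]ger0_norm ?addr_ge0// -sqrtr_sqr.
by rewrite ler_wsqrtr// sqrrD !real_normK ?num_real// addrAC lerDl mulrn_wge0//
  mulr_ge0.
Qed.

Lemma normc_ge_Im (z : R[i]) : `|complex.Im z|%:C <= `|z|.
Proof.
case: z => a b; rewrite normc_def lecR /= -sqrtr_sqr ler_wsqrtr//.
by rewrite lerDr sqr_ge0.
Qed.

(** Radii of balls in [R[i]] are themselves complex numbers; a positive one is real, so its real
    part serves as a radius in [R]. *)
Lemma nbhs_normc_ball (B : set C) (z : R[i]) : open B -> B z ->
  exists2 eps : R, 0 < eps & forall y : R[i], `|y - z| < eps%:C -> B y.
Proof.
move=> oB Bz; have /nbhs_ballP[e /= e0 eB] : nbhs (z : C) B by exact: open_nbhs_nbhs.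
have eE : e = (complex.Re e)%:C by rewrite RRe_real// gtr0_real.
rewrite eE in e0 eB; rewrite ltcR in e0; exists (complex.Re e) => // y yz.
by apply: eB; rewrite /ball /= distrC.
Qed.

Lemma normc_lt_ReIm (y z : R[i]) (eps : R) :
  `|complex.Re y - complex.Re z| < eps ->
  `|complex.Im y - complex.Im z| < eps -> `|y - z| < (eps + eps)%:C.
Proof.
move=> hr hi; apply: (le_lt_trans (normc_le_ReIm _)).
by rewrite ltcR !raddfB; exact: ltrD.
Qed.

Section Cvg.
Context {I : Type} {F : set_system I} {FF : Filter F}.
Implicit Types (f : I -> R[i]) (a : R[i]).

Lemma cvgcP f a : (f : I -> C) @ F --> (a : C) <->
  forall eps : R, 0 < eps -> \forall x \near F, `|f x - a| < eps%:C.
Proof.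
split=> [/cvgrPdist_lt h e e0|h].
  have e0' : 0 < e%:C by rewrite ltcR.
  by apply: filterS (h _ e0') => x; rewrite distrC.
apply/cvgrPdist_lt => e e0.
have eE : e = (complex.Re e)%:C by rewrite RRe_real// gtr0_real.
rewrite eE in e0 *; rewrite ltcR in e0.
by apply: filterS (h _ e0) => x; rewrite distrC.
Qed.

Lemma cvgc_ReIm f a :
  (fun x => complex.Re (f x)) @ F --> complex.Re a ->
  (fun x => complex.Im (f x)) @ F --> complex.Im a ->
  (f : I -> C) @ F --> (a : C).
Proof.
move=> /cvgrPdist_lt hr /cvgrPdist_lt hi; apply/cvgcP => e e0.
have e20 : 0 < e / 2 by rewrite divr_gt0.
apply: filterS2 (hr _ e20) (hi _ e20) => x hx hy.
by rewrite (splitr e); apply: normc_lt_ReIm; rewrite distrC.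
Qed.

Lemma cvgc_box f a : (f : I -> C) @ F --> (a : C) ->
  forall eps : R, 0 < eps -> \forall x \near F,
    `|complex.Re (f x) - complex.Re a| < eps /\
    `|complex.Im (f x) - complex.Im a| < eps.
Proof.
move=> /cvgcP h e e0; apply: filterS (h _ e0) => x hx; split.
  rewrite -raddfB -ltcR; exact: le_lt_trans (normc_ge_Re _) hx.
rewrite -raddfB -ltcR; exact: le_lt_trans (normc_ge_Im _) hx.
Qed.

End Cvg.

(** The real and imaginary parts push [F] forward to ultrafilters containing the compact segment
    from [- M] to [M], and these converge. *)
Lemma cvgc_bounded_ultra {I : Type} (F : set_system I) (f : I -> R[i]) (M : R) :
  UltraFilter F -> (\forall x \near F, `|f x| <= M%:C) ->
  exists a : R[i], (f : I -> C) @ F --> (a : C).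
Proof.
move=> UF fM.
have real_cvg (g : I -> R) : (\forall x \near F, `|g x| <= M) ->
    exists r : R, g @ F --> r.
  move=> gM.
  have := @segment_compact R (- M) M; rewrite compact_ultra => /(_ (g @ F)) [].
  - exact: fmap_ultra.
  - by apply: filterS gM => x /=; rewrite in_itv /= ler_norml.
  - by move=> r [_ hr]; exists r.
have [r hr] : exists r : R, (fun x => complex.Re (f x)) @ F --> r.
  apply: real_cvg; apply: filterS fM => x hx.
  by rewrite -lecR; apply: le_trans (normc_ge_Re _) hx.
have [s hs] : exists r : R, (fun x => complex.Im (f x)) @ F --> r.
  apply: real_cvg; apply: filterS fM => x hx.
  by rewrite -lecR; apply: le_trans (normc_ge_Im _) hx.
by exists (r +i* s); exact: cvgc_ReIm.
Qed.

End ComplexConvergence.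

(** * Ultrafilters on a Boolean algebra *)

Section BooleanUltrafilters.
Context {disp : Order.disp_t} {B : ctbDistrLatticeType disp}.
Implicit Types (U : set B) (a : B).

(** If the complement of [a] is not in [U], the filter [V] generated by [U] and [a] is proper, and
    maximality gives [V = U]. *)
Lemma ultrafilter_mem_or_compl U a :
  is_ultrafilter U -> U a \/ U (~` a)%O.
Proof.
move=> [[UT U0 UI US] Umax]; have [|nUa] := pselect (U (~` a)%O); [by right|left].
pose V : set B := [set b | exists2 c, U c & (c `&` a <= b)%O].
suff <- : V = U by exists \top%O => //; rewrite meet1x.
apply: Umax => [|b Ub]; last by exists b => //; exact: leIl.
split.
- by exists \top%O => //; exact: lex1.
- move=> [c Uc]; rewrite lex0 => /eqP ca0; apply: nUa; apply: US Uc.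
  by rewrite -disj_leC ca0.
- move=> b b' [c Uc cb] [c' Uc' cb']; exists (c `&` c')%O; first exact: UI.
  rewrite lexI (le_trans _ cb) ?(le_trans _ cb')//.
    by rewrite leI2// leIr.
  by rewrite leI2// leIl.
- by move=> b b' bb' [c Uc cb]; exists c => //; exact: le_trans cb bb'.
Qed.

Lemma is_ultrafilterW U : is_proper_filter U ->
  (forall a, U a \/ U (~` a)%O) -> is_ultrafilter U.
Proof.
move=> pU UC; split=> // V [VT V0 VI VS] UV; apply/seteqP; split=> // a Va.
have [//|Una] := UC a; exfalso; apply: V0.
by rewrite -(meetxC a); apply: VI => //; exact: UV.
Qed.

Lemma ultrafilterU U a b : is_ultrafilter U ->
  U (a `|` b)%O -> U a \/ U b.
Proof.
move=> uU Uab; have [|Una] := ultrafilter_mem_or_compl a uU; [by left|right].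
have [[_ _ UI US] _] := uU; apply: US (UI _ _ Uab Una).
by rewrite meetUl meetxC join0x leIl.
Qed.

End BooleanUltrafilters.

(** * From filters on the measure algebra to filters of sets, and back *)

Section MeasureAlgebra.
Context d (T : measurableType d) (R : realType).
Variable mu : {measure set T -> \bar R}.
Local Notation mc := (\pi_(measure_algebra mu)).
Implicit Types (A B : mblset T) (a b e : measure_algebra mu).

Lemma mblset_measurable A : measurable (val A).
Proof. exact/asboolP/(valP A). Qed.

Lemma malg_leP A B :
  (mc A <= mc B)%O <-> {ae mu, forall x, val A x -> val B x}.
Proof.
rewrite -[(_ <= _)%O]/(malgI _ _ == _) malgIE; split.
  by move=> /eqP/malg_piP; apply: filterS => x /= <- [].
move=> h; apply/eqP/malg_piP; apply: filterS h => x /= AB.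
by apply/propext; split=> [[]//|Ax]; split=> //; exact: AB.
Qed.

Lemma malg_eq0P A : mc A = \bot%O <-> {ae mu, forall x, ~ val A x}.
Proof.
rewrite -[\bot%O]/(mc (mblset0 T)) malg_piP; split.
  by apply: filterS => x /= ->.
by apply: filterS => x /= Ax; apply/propext; split.
Qed.

Lemma malg_meetE A B : (mc A `&` mc B)%O = mc (mblsetI A B).
Proof. exact: malgIE. Qed.

Lemma malg_complE A : (~` mc A)%O = mc (mblsetC A).
Proof. exact: malgCE. Qed.

(** Turns [U] into a filter on the points of [T], blind to null sets, so that limits along [U]
    become ordinary limits of functions. *)
Definition eventually (U : set (measure_algebra mu)) : set_system T :=
  [set P | exists2 A : mblset T, U (mc A) & {ae mu, forall x, val A x -> P x}].

Section ProperFilter.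
Variable U : set (measure_algebra mu).
Hypothesis pU : is_proper_filter U.

Lemma eventually_mem A : eventually U (val A) <-> U (mc A).
Proof.
have [_ _ _ US] := pU; split=> [[B UB BA]|UA]; last by exists A => //; exact: aeW.
by apply: US UB; exact/malg_leP.
Qed.

Lemma eventually_proper : ProperFilter (eventually U).
Proof.
have [UT U0 UI US] := pU; split.
  by move=> [A UA A0]; apply: U0; rewrite -(proj2 (malg_eq0P A)).
split.
- by exists (mblsetT T) => //; exact: aeW.
- move=> P Q [A UA AP] [B UB BQ]; exists (mblsetI A B).
    by rewrite -malg_meetE; exact: UI.
  by apply: filterS2 AP BQ => x hP hQ [Ax Bx]; split; [exact: hP|exact: hQ].
- by move=> P Q PQ [A UA AP]; exists A => //; apply: filterS AP => x h /h /PQ.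
Qed.

Lemma eventually_ae P : {ae mu, forall x, P x} -> eventually U P.
Proof.
have [UT _ _ _] := pU.
by move=> h; exists (mblsetT T) => //; apply: filterS h.
Qed.

(** Extend [eventually U] to an ultrafilter [H] of sets and keep the classes whose representative
    lies in [H]. As [H] contains every conull set, the choice of representative is immaterial. *)
Lemma ultrafilter_extension : exists2 V, is_ultrafilter V & U `<=` V.
Proof.
have PF := eventually_proper.
have [H [UH UleH]] := ultraFilterLemma PF.
have PH : ProperFilter H := ultra_proper.
have H_ae P : {ae mu, forall x, P x} -> H P.
  by move=> h; exact/UleH/eventually_ae.
pose V := [set e : measure_algebra mu | H (val (repr e))].
have VE A : V (mc A) <-> H (val A).
  have /malg_piP /H_ae AE := reprK (mc A).
  by split=> h; apply: filterS2 AE h => x /= e; rewrite e.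
exists V; last first.
  by elim/quotW=> A UA; apply/VE/UleH/eventually_mem.
apply: is_ultrafilterW; first split.
- by apply/(VE (mblsetT T)); exact: filterT.
- by move=> /(VE (mblset0 T)); exact: filter_not_empty.
- elim/quotW => A; elim/quotW => B /VE HA /VE HB.
  by rewrite malg_meetE; apply/VE; exact: filterI.
- elim/quotW => A; elim/quotW => B /malg_leP/H_ae AB /VE HA; apply/VE.
  by apply: filterS2 AB HA => x; apply.
- elim/quotW => A; rewrite malg_complE !VE.
  exact: in_ultra_setVsetC.
Qed.

End ProperFilter.

(** Only measurable sets have a class that [U] can decide; [eventually U] need not be an ultrafilter
    of sets. *)
Lemma eventually_setVsetC U P : is_ultrafilter U -> measurable P ->
  eventually U P \/ eventually U (~` P).
Proof.
move=> uU mP; have [pU _] := uU.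
have := ultrafilter_mem_or_compl (mc (MblSet mP)) uU.
by rewrite malg_complE -!eventually_mem.
Qed.

End MeasureAlgebra.

(** * Limits of essentially bounded functions along an ultrafilter of the measure algebra *)

Section Characters.
Context d (T : measurableType d) (R : realType).
Variable mu : {measure set T -> \bar R}.
Local Open Scope complex_scope.
Local Notation C := (R[i] : numFieldType).
Local Notation mc := (\pi_(measure_algebra mu)).
Local Notation pi := (\pi_(Linf mu)).
Implicit Types (A B : mblset T) (a b e : measure_algebra mu).
Implicit Types (f g : Linf_fun mu) (U : set (measure_algebra mu)).

Lemma Linf_fun_measurable f : complex_measurable (val f).
Proof. by have /asboolP[] := valP f. Qed.

(** A square instead of a disc: measurability and estimates of averages then reduce to the real and
    imaginary parts. *)
Definition cbox (h : T -> R[i]) (z : R[i]) (eps : R) : set T :=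
  [set x | `|complex.Re (h x) - complex.Re z| < eps /\
           `|complex.Im (h x) - complex.Im z| < eps].

Lemma measurable_cbox h z eps : complex_measurable h -> measurable (cbox h z eps).
Proof.
have mdist (k : T -> R) c : measurable_fun setT k ->
    measurable [set x | `|k x - c| < eps].
  move=> mk; have mkc : measurable_fun setT (fun x => `|k x - c|).
    by apply: measurableT_comp => //; exact: measurable_funB.
  rewrite (_ : [set x | _] = setT `&` (fun x => `|k x - c|) @^-1` `]-oo, eps[).
    exact: mkc.
  by apply/seteqP; split=> x /=; rewrite in_itv/=; [move=> ->|case].
by move=> [mr mi]; apply: measurableI; exact: mdist.
Qed.

(** A limit [z] exists along an ultrafilter [H] of sets finer than [eventually U]. The boxes around
    [z] are measurable, hence decided by [U], and their complements are excluded because [H]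
    contains the boxes. *)
Lemma ultrafilter_cvg U f : is_ultrafilter U ->
  exists z : R[i], (val f : T -> C) @ eventually U --> (z : C).
Proof.
move=> uU; have [pU _] := uU; have PF := eventually_proper pU.
have [H [UH UleH]] := ultraFilterLemma PF.
have PH : ProperFilter H := ultra_proper.
have /asboolP[mf [M fM]] := valP f.
have [z hz] := cvgc_bounded_ultra UH (UleH _ (eventually_ae pU fM)).
exists z; apply/cvgcP => eps eps0.
have e20 : 0 < eps / 2 by rewrite divr_gt0.
have Hbox : H (cbox (val f) z (eps / 2)) by exact: (cvgc_box hz).
have [Ubox|/UleH Hnbox] := eventually_setVsetC uU (measurable_cbox z (eps / 2) mf).
  by apply: filterS Ubox => x [hr hi]; rewrite (splitr eps); exact: normc_lt_ReIm.
by have [x []] := filter_ex (filterI Hbox Hnbox).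
Qed.

(** The character attached to [U], as a limit of values instead of averages; [ultralimP] identifies
    the two. The default 0 is never taken when [U] is an ultrafilter. *)
Definition ulim U (u : Linf mu) : R[i] :=
  xget 0 [set z : R[i] | (val (repr u) : T -> C) @ eventually U --> (z : C)].

Lemma cvg_ulim U f : is_ultrafilter U ->
  (val f : T -> C) @ eventually U --> (ulim U (pi f) : C).
Proof.
move=> uU; have [pU _] := uU; have PF := eventually_proper pU.
have [z hz] := @ultrafilter_cvg U (repr (pi f)) uU.
have h : (val (repr (pi f)) : T -> C) @ eventually U --> (ulim U (pi f) : C).
  by apply: (@xgetPex _ 0
    [set z : R[i] | (val (repr (pi f)) : T -> C) @ eventually U --> (z : C)]);
  exists z.
apply: cvg_trans h; apply: near_eq_cvg; apply: eventually_ae => //.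
by apply/Linf_piP; rewrite reprK.
Qed.

Lemma ulim_eq U f z : is_ultrafilter U ->
  (val f : T -> C) @ eventually U --> (z : C) -> ulim U (pi f) = z.
Proof.
move=> uU hz; have [pU _] := uU; have PF := eventually_proper pU.
by apply: (cvg_unique (@norm_hausdorff C C^o) (@cvg_ulim U f uU) hz).
Qed.

Lemma Linf_piD f g : pi f + pi g = pi (f + g).
Proof. exact: Linf_addE. Qed.
Lemma Linf_piN f : - pi f = pi (- f).
Proof. exact: Linf_oppE. Qed.
Lemma Linf_piM f g : pi f * pi g = pi (f * g).
Proof. exact: Linf_mulE. Qed.
Lemma Linf_piZ (k : R[i]) f : k *: pi f = pi (k *: f).
Proof. exact: Linf_scaleE. Qed.
Lemma Linf_pi1 : 1 = pi 1.
Proof. by []. Qed.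

Lemma ulim_character U : is_ultrafilter U -> is_character (ulim U).
Proof.
move=> uU; have [pU _] := uU; have PF := eventually_proper pU; split.
- move=> k; elim/quotW => f; elim/quotW => g; rewrite Linf_piZ Linf_piD.
  apply: ulim_eq => //.
  have -> : val (k *: f + g) = (fun x => k * val f x + val g x) by [].
  apply: (@cvgD C C^o); last exact: cvg_ulim.
  by apply: (@cvgM C); [exact: cvg_cst|exact: cvg_ulim].
- elim/quotW => f; elim/quotW => g; rewrite Linf_piM.
  apply: ulim_eq => //.
  have -> : val (f * g) = (fun x => val f x * val g x) by [].
  by apply: (@cvgM C); exact: cvg_ulim.
- exists 1; rewrite Linf_pi1 (@ulim_eq U 1 1) //; last exact: cvg_cst.
  exact/eqP/oner_neq0.
Qed.

Lemma Linf_indicI a b : Linf_indic (a `&` b)%O = Linf_indic a * Linf_indic b.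
Proof.
elim/quotW: a => A; elim/quotW: b => B.
rewrite malg_meetE !Linf_indicE Linf_piM; congr (pi _); apply/val_inj/funext => x.
by rewrite /= indicI.
Qed.

Lemma Linf_indicC a : Linf_indic (~` a)%O = 1 - Linf_indic a.
Proof.
elim/quotW: a => A; rewrite malg_complE !Linf_indicE Linf_pi1 Linf_piN Linf_piD.
congr (pi _); apply/val_inj/funext => x.
rewrite -[RHS]/(1 - \1_(val A) x) /= indicC.
by rewrite indicE; case: (x \in val A); rewrite /= ?subrr ?subr0.
Qed.

Lemma Linf_indic0 : Linf_indic (\bot%O : measure_algebra mu) = 0.
Proof.
rewrite -[\bot%O]/(mc (mblset0 T)) Linf_indicE -[0]/(pi 0).
by congr (pi _); apply/val_inj; rewrite /= indic0.
Qed.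

(** Outside the box the modulus of [f - z] is at least [eps], so its inverse cut off to [P] is
    bounded by [eps^-1]. Hence any character that kills [f - z] kills the indicator of [P]. *)
Lemma indic_multiple f (z : R[i]) (eps : R) : 0 < eps ->
  let P := ~` cbox (val f) z eps in
  exists g : Linf_fun mu, forall x, val g x * (val f x - z) = \1_P x.
Proof.
move=> e0 P; have [mr mi] := Linf_fun_measurable f.
have mP : measurable P by exact/measurableC/measurable_cbox.
have Peps x : P x -> eps%:C <= `|val f x - z|.
  rewrite /P /cbox /= => /not_andP h; case: h => /negP; rewrite -leNgt => h.
    by apply: le_trans (normc_ge_Re _); rewrite lecR raddfB.
  by apply: le_trans (normc_ge_Im _); rewrite lecR raddfB.
pose a x := complex.Re (val f x) - complex.Re z.
pose b x := complex.Im (val f x) - complex.Im z.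
have ma : measurable_fun setT a by exact: measurable_funB.
have mb : measurable_fun setT b by exact: measurable_funB.
(* On [P] this is the inverse squared modulus of [f - z]; the cut-off inverse is [m] times the
   conjugate of [f - z], which gives measurability by components. *)
pose m x : R := \1_P x * ((a x * a x + b x * b x) `^ (-1)).
have mm : measurable_fun setT m.
  apply: measurable_funM; first exact: measurable_indic.
  apply: (measurableT_comp (measurable_powR _)).
  by apply: measurable_funD; exact: measurable_funM.
pose g x : R[i] := \1_P x * (val f x - z)^-1.
have gE x : g x = (m x * a x) +i* (- (m x * b x)).
  rewrite /g /m /a /b -!raddfB powR_inv1; last by rewrite addr_ge0// -expr2 sqr_ge0.
  rewrite !indicE; case: (x \in P); last by rewrite !mul0r oppr0.
  rewrite !mul1r -!expr2 ![_^-1 * _]mulrC.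
  by case: (val f x - z).
have Lg : Linf_pred mu g.
  apply/asboolP; split; first split.
  - rewrite (_ : (fun _ => _) = m \* a); first exact: measurable_funM.
    by apply/funext => x; rewrite gE.
  - rewrite (_ : (fun _ => _) = \- (m \* b)).
      by apply: measurableT_comp => //; exact: measurable_funM.
    by apply/funext => x; rewrite gE.
  exists eps^-1; apply: aeW => x; rewrite /g indicE.
  have [/set_mem Px|_] := boolP (x \in P); last first.
    by rewrite mul0r normr0 ler0c invr_ge0 ltW.
  have h0 : 0 < `|val f x - z| by apply: lt_le_trans (Peps _ Px); rewrite ltcR.
  rewrite mul1r normfV (_ : eps^-1%:C = eps%:C^-1).
    rewrite lef_pV2; [exact: Peps|exact: h0|by rewrite posrE ltcR].
  by rewrite -[RHS](fmorphV (real_complex R)).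
exists (exist _ g Lg) => x; rewrite /= /g indicE.
have [/set_mem Px|_] := boolP (x \in P); last by rewrite !mul0r.
rewrite mul1r mulVf// -normr_gt0.
by apply: lt_le_trans (Peps _ Px); rewrite ltcR.
Qed.

(** * The ultrafilter of a character *)

Section Character.
Variable w : Linf mu -> R[i].
Hypothesis cw : is_character w.
Implicit Types u v : Linf mu.

Lemma characterM u v : w (u * v) = w u * w v.
Proof. by have [_ wM _] := cw. Qed.

Lemma character1 : w 1 = 1.
Proof.
have [_ _ [u /eqP u0]] := cw; apply: (mulfI u0).
by rewrite -characterM !mulr1.
Qed.

Lemma characterB u v : w (u - v) = w u - w v.
Proof.
by have [wS _ _] := cw; rewrite addrC -scaleN1r wS mulN1r addrC.
Qed.

Lemma character_cst (z : R[i]) : w (z *: (1 : Linf mu)) = z.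
Proof.
have [wS _ _] := cw.
have w0 : w 0 = 0 by rewrite -(subrr 0) characterB subrr.
by rewrite -[z *: (1 : Linf mu)]addr0 wS character1 w0 addr0 mulr1.
Qed.

Definition character_ultrafilter : set (measure_algebra mu) :=
  [set e | w (Linf_indic e) = 1].

Lemma character_indicC e : w (Linf_indic (~` e)%O) = 1 - w (Linf_indic e).
Proof. by rewrite Linf_indicC characterB character1. Qed.

(** The indicators of [e] and of its complement multiply to 0 and sum to 1. *)
Lemma character_indic_dichotomy e :
  w (Linf_indic e) = 1 \/ w (Linf_indic e) = 0.
Proof.
have : w (Linf_indic e) * w (Linf_indic (~` e)%O) = 0.
  by rewrite -characterM -Linf_indicI meetxC Linf_indic0 -(subrr 0) characterB subrr.
rewrite character_indicC => /eqP; rewrite mulf_eq0 subr_eq0.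
by case/orP => /eqP; [right|left].
Qed.

Lemma is_ultrafilter_character : is_ultrafilter character_ultrafilter.
Proof.
have i0 : w (Linf_indic (\bot%O : measure_algebra mu)) = 0.
  by rewrite Linf_indic0 -(subrr 0) characterB subrr.
apply: is_ultrafilterW; rewrite /character_ultrafilter /=; first split.
- by rewrite /= -compl0 character_indicC i0 subr0.
- by rewrite /= i0 => /esym/eqP; rewrite oner_eq0.
- by move=> a b /= wa wb; rewrite Linf_indicI characterM wa wb mulr1.
- move=> a b /meet_idPl <- /=; rewrite Linf_indicI characterM.
  by case: (character_indic_dichotomy b) => -> //; rewrite mulr0 => ->.
- move=> a; rewrite character_indicC.
  by case: (character_indic_dichotomy a) => ->; [left|right; rewrite subr0].
Qed.

(* No continuity of [w] is needed: on the set where [f] is away from [w f], the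
   function [f - w f] has a bounded inverse, while [w (f - w f) = 0], so [w] kills
   the indicator of that set *)
Lemma ulim_character_ultrafilter u : ulim character_ultrafilter u = w u.
Proof.
have uV := is_ultrafilter_character; have [pV _] := uV.
have PF := eventually_proper pV.
elim/quotW: u => f; apply: ulim_eq => //; apply/cvgcP => eps eps0.
have e20 : 0 < eps / 2 by rewrite divr_gt0.
have mf := Linf_fun_measurable f; set z := w (pi f).
have mE := measurable_cbox z (eps / 2) mf.
have [Ebox|Enbox] := eventually_setVsetC uV mE.
  by apply: filterS Ebox => x [hr hi]; rewrite (splitr eps); exact: normc_lt_ReIm.
have [g gE] := indic_multiple f z e20.
have wP : w (pi (Linf_fun_indic mu (MblSet (measurableC mE)))) = 1.
  rewrite -Linf_indicE; exact/(eventually_mem pV).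
suff : w (pi (Linf_fun_indic mu (MblSet (measurableC mE)))) = 0.
  by rewrite wP => /eqP; rewrite oner_eq0.
have -> : pi (Linf_fun_indic mu (MblSet (measurableC mE))) =
    pi g * (pi f - z *: (1 : Linf mu)).
  rewrite Linf_pi1 Linf_piZ Linf_piN Linf_piD Linf_piM; congr (pi _).
  apply/val_inj/funext => x; rewrite -[LHS]gE.
  have -> : val (g * (f - z *: (1 : Linf_fun mu))) x =
    val g x * (val f x - z * 1) by [].
  by rewrite mulr1.
by rewrite characterM characterB character_cst subrr mulr0.
Qed.

End Character.

(** If [e] is not in [U], its complement is, whose indicator then has limit 1; so the indicator of
    [e] has limit 0. *)
Lemma ulim_indicP U e : is_ultrafilter U ->
  ulim U (Linf_indic e) = 1 <-> U e.
Proof.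
move=> uU; have [pU _] := uU; have PF := eventually_proper pU.
have ulim1 : forall a, U a -> ulim U (Linf_indic a) = 1.
  elim/quotW => A /(eventually_mem pU) UA; rewrite Linf_indicE; apply: ulim_eq => //.
  apply/cvgcP => eps eps0; apply: filterS UA => x Ax.
  by rewrite /= indicE mem_set// subrr normr0 ltcR.
split; last exact: ulim1.
have [//|/ulim1] := ultrafilter_mem_or_compl e uU.
rewrite (character_indicC (ulim_character uU)) => + e1.
by rewrite e1 subrr => /esym/eqP; rewrite oner_eq0.
Qed.

(** * Averages, and their agreement with limits of values *)

Lemma average_near (X : set T) (g : T -> R) (c eps : R) :
  measurable X -> (0 < mu X < +oo)%E -> measurable_fun setT g ->
  (forall x, X x -> `|g x - c| <= eps) ->
  `|(fine (mu X))^-1 * (\int[mu]_(x in X) g x) - c| <= eps.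
Proof.
move=> mX /andP[X0 Xoo] mg gc.
have m0 : 0 < fine (mu X) by rewrite fine_gt0// X0.
have icst k : mu.-integrable X (EFin \o cst k).
  apply/integrableP; split; first exact/measurable_EFinP/measurable_cst.
  by rewrite /= integral_cst// lte_mul_pinfty.
have ig : mu.-integrable X (EFin \o g).
  apply: (le_integrable mX _ _ (icst (`|c| + eps))).
    by apply/measurable_EFinP; exact: measurable_funTS.
  move=> x Xx /=; rewrite lee_fin [leRHS]ger0_norm; last first.
    by rewrite addr_ge0// (le_trans _ (gc _ Xx)).
  by rewrite -lerBlDl (le_trans (lerB_dist _ _))// gc.
have gbnd x : X x -> c - eps <= g x <= c + eps.
  by move=> /gc; rewrite ler_distl.
rewrite ler_distl ler_pdivlMl// ler_pdivrMl// ![fine _ * _]mulrC.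
rewrite -!Rintegral_cst//; apply/andP; split; apply: le_Rintegral => //; try exact: icst.
- by move=> x /gbnd /andP[].
- by move=> x /gbnd /andP[].
Qed.

(** Averaging keeps only non-strict bounds: each component is off by at most [eps / 4], and the sum
    [eps / 2] leaves room for the strict inequality. *)
Lemma average_box (X : set T) f (z : R[i]) (eps : R) :
  measurable X -> (0 < mu X < +oo)%E -> 0 < eps ->
  X `<=` cbox (val f) z (eps / 4) -> `|average mu X (val f) - z| < eps%:C.
Proof.
move=> mX X0 e0 Xbox; have [mr mi] := Linf_fun_measurable f.
have hr := average_near mX X0 mr (fun x Xx => ltW (proj1 (Xbox x Xx))).
have hi := average_near mX X0 mi (fun x Xx => ltW (proj2 (Xbox x Xx))).
apply: (le_lt_trans (normc_le_ReIm _)); rewrite ltcR.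
have -> : average mu X (val f) =
    ((fine (mu X))^-1 * (\int[mu]_(x in X) complex.Re (val f x))) +i*
    ((fine (mu X))^-1 * (\int[mu]_(x in X) complex.Im (val f x))).
  by rewrite /average; simpc.
rewrite !raddfB /=; apply: (le_lt_trans (lerD hr hi)).
by rewrite -mulrDr gtr_pMr// (_ : 4^-1 + 4^-1 = 2^-1 :> R) ?invf_lt1 ?ltr1n//; lra.
Qed.

Lemma semifinite_subset (E : set T) : semifinite mu -> measurable E ->
  (0 < mu E)%E -> exists X, [/\ measurable X, X `<=` E & (0 < mu X < +oo)%E].
Proof.
move=> sf mE E0; have [/sf|Eoo] := eqVneq (mu E) +oo%E; first exact.
by exists E; split=> //; rewrite E0 ltey.
Qed.

(** Boxes around [ulim U u] belong to [U] and control averages. For uniqueness, members [F] and [G]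
    of [U] witnessing two limits meet in a non-null set; by semifiniteness it contains some [X] of
    positive finite measure, whose single average would be within half their distance of both. *)
Lemma ultralimP U u (z : R[i]) : semifinite mu -> is_ultrafilter U ->
  ultralim U u z <-> z = ulim U u.
Proof.
move=> sf uU; have [pU _] := uU; have [_ U0 UI US] := pU.
have PF := eventually_proper pU.
have lim_ulim : ultralim U u (ulim U u).
  move=> eps eps0; have e40 : 0 < eps / 4 by rewrite divr_gt0.
  have mbox := measurable_cbox (ulim U u) (eps / 4) (Linf_fun_measurable (repr u)).
  exists (MblSet mbox); split.
    have hu : (val (repr u) : T -> C) @ eventually U --> (ulim U u : C).
      by rewrite -{2}(reprK u); exact: cvg_ulim.
    by apply/(eventually_mem pU); exact: (cvgc_box hu).
  by move=> X mX Xbox X0; exact: average_box.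
split=> [limz|->//].
apply/eqP/negPn/negP => zneq; set e := complex.Re `|z - ulim U u|.
have eE : e%:C = `|z - ulim U u| by rewrite RRe_real// normr_real.
have e20 : 0 < e / 2.
  by rewrite divr_gt0// -ltcR eE normr_gt0 subr_eq0.
have [F [UF hF]] := limz _ e20; have [G [UG hG]] := lim_ulim _ e20.
have FG0 : (0 < mu (val F `&` val G))%E.
  rewrite lt0e measure_ge0 andbT; apply/eqP => FG; apply: U0.
  have <- : mc (mblsetI F G) = \bot%O.
    apply/malg_eq0P; exists (val F `&` val G); split=> //.
      exact: (mblset_measurable (mblsetI F G)).
    by move=> x /= /contrapT.
  by rewrite -malg_meetE; exact: UI.
have [X [mX XFG X0]] :=
  semifinite_subset sf (mblset_measurable (mblsetI F G)) FG0.
have XF : X `<=` val F by move=> x /XFG[].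
have XG : X `<=` val G by move=> x /XFG[].
have := ltrD (hF X mX XF X0) (hG X mX XG X0).
have -> : (e / 2)%:C + (e / 2)%:C = `|z - ulim U u|.
  by rewrite -eE [in RHS](splitr e) [RHS](rmorphD (real_complex R)).
rewrite [X in X + _ < _]distrC => /lt_geF/negP; apply.
by apply: le_trans (ler_normD _ _); rewrite addrA subrK distrC.
Qed.

(** * Clopen subsets of the spectrum *)

Section Spectrum.
Local Notation spec := (spectrum mu).

Lemma spectrumP (w : spec) : is_character (\val w).
Proof. exact: set_valP. Qed.

Definition ulim_spectrum U (uU : is_ultrafilter U) : spec :=
  exist _ (ulim U) (mem_set (ulim_character uU)).

(** The clopen set corresponding to [e]: a character lies in it exactly when its ultrafilter
    contains [e], as in Stone duality. *)
Definition basic_clopen e : set spec :=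
  [set w | gelfand (Linf_indic e) w = 1].

Lemma basic_clopenP e (w : spec) :
  basic_clopen e w <-> character_ultrafilter (\val w) e.
Proof. by []. Qed.

Lemma basic_clopen_ulim U (uU : is_ultrafilter U) e :
  basic_clopen e (ulim_spectrum uU) <-> U e.
Proof. exact: ulim_indicP. Qed.

Lemma basic_clopenU a b :
  basic_clopen (a `|` b)%O = basic_clopen a `|` basic_clopen b.
Proof.
apply/seteqP; split=> w; have uw := is_ultrafilter_character (spectrumP w).
  exact: (ultrafilterU uw).
have [[_ _ _ US] _] := uw.
by move=> [|]; apply: US; [exact: leUl|exact: leUr].
Qed.

Lemma basic_clopenC e : basic_clopen (~` e)%O = ~` basic_clopen e.
Proof.
apply/seteqP; split=> w; have uw := is_ultrafilter_character (spectrumP w);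
  have [[_ U0 UI _] _] := uw.
  by move=> /= wCe we; apply: U0; rewrite -(meetxC e); exact: UI.
by move=> nwe; have [|] := ultrafilter_mem_or_compl e uw.
Qed.

Lemma basic_clopen0 : basic_clopen \bot%O = set0.
Proof.
apply/seteqP; split=> // w we.
by have [[_ + _ _] _] := is_ultrafilter_character (spectrumP w); apply.
Qed.

(** If [e] is not below [e'], the principal filter of [e] minus [e'] is proper; an ultrafilter
    extending it yields a character in the first set but not in the second. *)
Lemma basic_clopen_inj : injective basic_clopen.
Proof.
suff le_of_eq e e' : basic_clopen e = basic_clopen e' -> (e <= e')%O.
  by move=> e e' ee'; apply/le_anti/andP; split; exact: le_of_eq.
move=> ee'; rewrite -[e']complK -disj_leC; apply/eqP; apply: contrapT => ne.
have pV : is_proper_filter [set c | (e `&` ~` e' <= c)%O].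
  split; rewrite /= ?lex1//.
  - by rewrite lex0 => /eqP.
  - by move=> a b /= ha hb; rewrite lexI ha.
  - by move=> a b ab ha; exact: le_trans ha ab.
have [U uU VU] := ultrafilter_extension pV.
have : basic_clopen e (ulim_spectrum uU).
  by apply/basic_clopen_ulim/VU; rewrite /= leIl.
have : basic_clopen (~` e')%O (ulim_spectrum uU).
  by apply/basic_clopen_ulim/VU; rewrite /= leIr.
by rewrite basic_clopenC ee'.
Qed.

Lemma gelfand_continuous u : continuous (gelfand u : spec -> C).
Proof.
move=> w; apply: (@continuous_comp spec
  (prod_topology (fun _ : Linf mu => C)) C set_val (fun h => h u)).
  exact: initial_continuous.
exact: (@proj_continuous _ (fun _ : Linf mu => C)).
Qed.

Lemma clopen_basic_clopen e : clopen (basic_clopen e).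
Proof.
have cl a : closed (basic_clopen a).
  apply: (@closed_comp spec C (gelfand (Linf_indic a)) [set 1]).
    by move=> w _; exact: gelfand_continuous.
  exact/accessible_closed_set1/hausdorff_accessible/(@norm_hausdorff C C^o).
split; last exact: cl.
by rewrite -(setCK (basic_clopen e)) openC -basic_clopenC.
Qed.

(** The basic clopen sets around [w] generate a filter [G], and in the product topology it is enough
    that [G] converges to [w] in each coordinate [f]. *)
Lemma basic_clopen_base (w : spec) (K : set spec) : open K -> K w ->
  exists2 e, basic_clopen e w & basic_clopen e `<=` K.
Proof.
move=> oK Kw.
have uw := is_ultrafilter_character (spectrumP w); have [pw _] := uw.
have [wT _ wI wS] := pw; have PF := eventually_proper pw.
pose G : set_system (prod_topology (fun _ : Linf mu => C)) :=
  [set P | exists2 e, basic_clopen e w &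
    forall w' : spec, basic_clopen e w' -> P (\val w')].
have FG : Filter G.
  split.
  - by exists \top%O.
  - move=> P Q [a wa aP] [b wb bQ]; exists (a `&` b)%O; first exact: wI.
    move=> w'; have [[_ _ _ US] _] := is_ultrafilter_character (spectrumP w').
    move=> w'ab; split; [apply: aP|apply: bQ]; apply: US w'ab.
      exact: leIl.
    exact: leIr.
  - by move=> P Q PQ [a wa aP]; exists a => // w' /aP /PQ.
have Gw : G --> (\val w : prod_topology (fun _ : Linf mu => C)).
  apply/cvg_sup => u A [V] [[B] oB <-] Bw BA.
  apply: (filterS BA) => {V A BA}.
  have [eps eps0 epsB] := nbhs_normc_ball oB Bw.
  have e40 : 0 < eps / 4 by rewrite divr_gt0.
  elim/quotW: u Bw epsB => f Bw epsB.
  have mE := measurable_cbox (\val w (pi f)) (eps / 4) (Linf_fun_measurable f).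
  (* The class of the set where [f] is in the box around [w f] works: it is in the ultrafilter of
     [w], and any [w'] whose ultrafilter contains it has [w' f] near [w f]. *)
  exists (mc (MblSet mE)).
    apply/basic_clopenP/(eventually_mem pw).
    have := cvg_ulim (f := f) uw.
    by rewrite (ulim_character_ultrafilter (spectrumP w)) => /cvgc_box; exact.
  move=> w'; have uw' := is_ultrafilter_character (spectrumP w').
  have [pw' _] := uw'; have PF' := eventually_proper pw'.
  move=> /basic_clopenP/(eventually_mem pw') w'E; apply: epsB.
  have := cvg_ulim (f := f) uw'.
  rewrite (ulim_character_ultrafilter (spectrumP w')) => /cvgcP /(_ _ e40) w'f.
  (* At such a point [x], [f x] is within [eps / 4] of [w' f] and within twice that of [w f], for a
     total below [eps]. *)
  have [x [[hr hi] hx]] := filter_ex (filterI w'E w'f).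
  have hz := normc_lt_ReIm hr hi.
  rewrite distrC in hx; rewrite -(subrKA (val f x)).
  apply: (le_lt_trans (ler_normD _ _)); apply: (lt_trans (ltrD hx hz)).
  by rewrite -[X in X < _](rmorphD (real_complex R)) ltcR; lra.
have [B oB KE] := oK.
have : nbhs (\val w : prod_topology (fun _ : Linf mu => C)) B.
  by apply: open_nbhs_nbhs; split=> //; move: Kw; rewrite -KE.
move=> /Gw [e we eB]; exists e => // w' /eB.
by rewrite -KE.
Qed.

(* Replaces the compactness of the spectrum: if no basic clopen sets inside [K]
   and inside [~` K] together cover it, the complements of such unions generate
   a proper filter, and an ultrafilter extending it is a point without any basic
   neighbourhood inside [K] or inside [~` K] *)
Lemma clopen_basic K : clopen K -> exists e, K = basic_clopen e.
Proof.
move=> [oK cK]; apply: contrapT => noK.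
pose V := [set c : measure_algebra mu | exists a b,
  [/\ basic_clopen a `<=` K, basic_clopen b `<=` ~` K & (~` (a `|` b) <= c)%O]].
have pV : is_proper_filter V.
  split.
  - by exists \bot%O, \bot%O; split; rewrite ?lex1// basic_clopen0.
  (* Otherwise [a] and [b] join to the top, their basic sets cover the spectrum, and [K] is the
     basic set of [a]. *)
  - move=> [a [b [aK bK]]]; rewrite lex0 -compl1 => /eqP /compl_inj abT.
    apply: noK; exists a; apply/seteqP; split=> // w Kw.
    have : basic_clopen (a `|` b)%O w.
      rewrite abT; apply/basic_clopenP.
      by have [[]] := is_ultrafilter_character (spectrumP w).
    by rewrite basic_clopenU => -[//|/bK].
  - move=> c c' [a [b [aK bK abc]]] [a' [b' [aK' bK' abc']]].
    exists (a `|` a')%O, (b `|` b')%O; rewrite !basic_clopenU; split.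
    + by move=> w [/aK|/aK'].
    + by move=> w [/bK|/bK'].
    + by rewrite joinACA complU lexI (le_trans _ abc) ?leIl// (le_trans _ abc') ?leIr.
  - move=> c c' cc' [a [b [aK bK abc]]]; exists a, b; split=> //.
    exact: le_trans abc cc'.
have [U uU VU] := ultrafilter_extension pV.
have [[_ U0 UI _] _] := uU.
have [Kw|nKw] := pselect (K (ulim_spectrum uU)).
  have [e /basic_clopen_ulim Ue eK] := basic_clopen_base oK Kw.
  apply: U0; rewrite -(meetxC e); apply: UI => //; apply: VU.
  by exists e, \bot%O; split; rewrite ?joinx0// basic_clopen0.
have oKC : open (~` K) by rewrite openC.
have [e /basic_clopen_ulim Ue eK] := basic_clopen_base oKC nKw.
apply: U0; rewrite -(meetxC e); apply: UI => //; apply: VU.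
by exists \bot%O, e; split; rewrite ?join0x// basic_clopen0.
Qed.

Lemma gelfand_indic e : gelfand (Linf_indic e) = \1_(basic_clopen e).
Proof.
apply/funext => w; rewrite indicE; have [/set_mem//|/negP we] := boolP (w \in _).
have [h|//] := character_indic_dichotomy (spectrumP w) e.
by exfalso; apply: we; exact: mem_set.
Qed.

(** The class [e] itself rules out the default value, and injectivity of [basic_clopen] rules out
    any other choice. *)
Lemma clopen_to_malgK e : clopen_to_malg (basic_clopen e) = e.
Proof.
rewrite /clopen_to_malg; case: xgetP => [e' _ /= |/(_ e)]; last first.
  by rewrite /= gelfand_indic.
by rewrite -gelfand_indic => h; apply: basic_clopen_inj; rewrite /basic_clopen h.
Qed.

Lemma ultrafilter_atE (w : spec) :
  ultrafilter_at w = character_ultrafilter (\val w).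
Proof.
apply/seteqP; split=> [_ [K [/clopen_basic[e ->] we] <-]|e we].
  by rewrite clopen_to_malgK.
exists (basic_clopen e); rewrite ?clopen_to_malgK//.
by split=> //; exact: clopen_basic_clopen.
Qed.

End Spectrum.
End Characters.

Theorem theorem7 (R : realType) (d : measure_display) (T : measurableType d)
    (mu : {measure set T -> \bar R}) :
  semifinite mu -> decomposable mu ->
  exists (omega : ultrafilter (measure_algebra mu) -> spectrum mu)
         (Uat : spectrum mu -> ultrafilter (measure_algebra mu)),
  [/\ forall (U : ultrafilter (measure_algebra mu)) (f : Linf mu) (a : R[i]%C),
        ultralim (\val U) f a <-> a = gelfand f (omega U),
      forall w : spectrum mu, \val (Uat w) = ultrafilter_at w,
      cancel omega Uat &
      cancel Uat omega].

Proof.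
move=> sf _.
pose omega (U : ultrafilter (measure_algebra mu)) : spectrum mu :=
  ulim_spectrum (set_valP U).
pose Uat (w : spectrum mu) : ultrafilter (measure_algebra mu) :=
  exist _ (character_ultrafilter (\val w))
    (mem_set (is_ultrafilter_character (spectrumP w))).
exists omega, Uat; split.
- by move=> U f a; exact: ultralimP sf (set_valP U).
- by move=> w; rewrite ultrafilter_atE.
(* The ultrafilter of the character [ulim U] consists of the classes whose indicator has limit 1
   along [U], which are the members of [U]. *)
- move=> U; apply/val_inj/seteqP.
  by split=> e /(ulim_indicP e (set_valP U)).
- move=> w; apply/val_inj/funext => u.
  exact: ulim_character_ultrafilter (spectrumP w) u.
Qed.
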